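(* (Green's function, initial value problem) Let $A,B,F,G$ be real $n\times n$ matrices with $F+G$ and $F-G$ invertible, let $\gamma:\mathbb R\to\mathbb R^n$ be continuous and $\delta\in\mathbb R^n$. Let $X$ and $Y$ be fundamental matrices of the homogeneous systems $$Fu'(t)+Gu'(-t)+Au(t)+Bu(-t)=0\quad\text{and}\quad Fu'(t)-Gu'(-t)+Au(t)-Bu(-t)=0,\qquad t\in\mathbb R,$$ respectively, and suppose that $\mathcal X(t)=\left(\begin{array}{c|c}X_e(t)&Y_o(t)\\\hline X_o(t)&Y_e(t)\end{array}\right)$ is invertible for every $t\in\mathbb R$. Then the problem $$Fu'(t)+Gu'(-t)+Au(t)+Bu(-t)=\gamma(t),\ t\in\mathbb R,\qquad u(0)=\delta,$$ has a unique solution $u:\mathbb R\to\mathbb R^n$, and it is given by $$u(t)=X(t)X(0)^{-1}\delta+\int_{-t}^t\mathcal G(t,s)\gamma(s)\,ds,$$ where $$\mathcal G(t,s)=\begin{cases}\dfrac12\bigl(X(t)\,|\,Y(t)\bigr)\mathcal X(s)^{-1}\begin{pmatrix}(F-G)^{-1}\\(F+G)^{-1}\end{pmatrix},& 0\le s\le t,\\[2ex]\dfrac12\bigl(X(t)\,|\,Y(t)\bigr)\mathcal X(-s)^{-1}\begin{pmatrix}-(F-G)^{-1}\\(F+G)^{-1}\end{pmatrix},&-t\le s<0.\end{cases}$$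
   Context: For a function $f$ on $\mathbb R$, $f_e(t)=\tfrac12(f(t)+f(-t))$ and $f_o(t)=\tfrac12(f(t)-f(-t))$ are its even and odd parts. $(X(t)\,|\,Y(t))$ is the $n\times 2n$ block matrix. $u'(-t)$ is the derivative of $u$ evaluated at $-t$. A fundamental matrix of $F u'(t)+G u'(-t)+Au(t)+Bu(-t)=0$, $t\in\mathbb R$, is a continuous $X:\mathbb R\to M_n(\mathbb R)$ that is differentiable, satisfies $FX'(t)+GX'(-t)+AX(t)+BX(-t)=0$ for all $t\in\mathbb R$, has $X(0)$ invertible, and whose columns form a basis of the space of solutions of the system; for the second system replace $G,B$ by $-G,-B$. *)

(* Defs.v *)
From HB Require Import structures.
From mathcomp Require Import all_boot all_order all_algebra.
From mathcomp Require Import all_classical all_reals all_analysis.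

Set Implicit Arguments.
Unset Strict Implicit.
Unset Printing Implicit Defensive.

Import Order.TTheory GRing.Theory Num.Theory.
Import numFieldNormedType.Exports.

Local Open Scope ring_scope.
Local Open Scope classical_set_scope.

Definition even_part (R : realType) (V : lmodType R) (f : R -> V) (t : R) : V :=
  2^-1 *: (f t + f (- t)).

Definition odd_part (R : realType) (V : lmodType R) (f : R -> V) (t : R) : V :=
  2^-1 *: (f t - f (- t)).

(* The parameter m covers vector functions (m = 1) and matrix functions
   (m = n) alike.  [u^`() (- t)] is the derivative of u evaluated at - t. *)
Definition refl_op (R : realType) (n m : nat) (F G A B : 'M[R]_n)
    (u : R -> 'M[R]_(n, m)) (t : R) : 'M[R]_(n, m) :=
  F *m u^`()%classic t + G *m u^`()%classic (- t) + A *m u t + B *m u (- t).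

Definition refl_solution (R : realType) (n m : nat) (F G A B : 'M[R]_n)
    (g u : R -> 'M[R]_(n, m)) : Prop :=
  (forall t, derivable u t 1) /\ (forall t, refl_op F G A B u t = g t).

Definition family_basis (R : realType) (V : lmodType R) (n : nat)
    (S : set V) (b : 'I_n -> V) : Prop :=
  [/\ forall i, S (b i),
      forall c : 'I_n -> R, \sum_i c i *: b i = 0 -> forall i, c i = 0
    & forall v, S v -> exists c : 'I_n -> R, v = \sum_i c i *: b i].

Definition fundamental_matrix (R : realType) (n : nat) (F G A B : 'M[R]_n)
    (X : R -> 'M[R]_n) : Prop :=
  [/\ continuous X,
      refl_solution F G A B (fun=> 0) X,
      X 0 \in unitmx
    & family_basis
        [set u : R -> 'cV[R]_n | refl_solution F G A B (fun=> 0) u]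
        (fun (i : 'I_n) (t : R) => col i (X t))].

Definition block_fundamental (R : realType) (n : nat) (X Y : R -> 'M[R]_n)
    (t : R) : 'M[R]_(n + n) :=
  block_mx (even_part X t) (odd_part Y t) (odd_part X t) (even_part Y t).

(* For t >= 0 the two cases are 0 <= s <= t and - t <= s < 0.  For t < 0, where
   an integral from - t to t runs backwards, they are read as "s lies between
   0 and t" and "s lies between - t and 0": this is the reading under which the
   variation of constants formula holds on the whole line (splitting by the
   sign of s alone would fail for t < 0).  The value 0 outside
   [- |t|, |t|] is never used. *)
Definition green (R : realType) (n : nat) (F G : 'M[R]_n) (X Y : R -> 'M[R]_n)
    (t s : R) : 'M[R]_n :=
  if (0 <= s <= t) || (t <= s <= 0) then
    2^-1 *: (row_mx (X t) (Y t) *m invmx (block_fundamental X Y s)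
             *m col_mx (invmx (F - G)) (invmx (F + G)))
  else if (- t <= s < 0) || (0 < s <= - t) then
    2^-1 *: (row_mx (X t) (Y t) *m invmx (block_fundamental X Y (- s))
             *m col_mx (- invmx (F - G)) (invmx (F + G)))
  else 0.

Definition oriented_integral (R : realType) (a b : R) (f : R -> R) : R :=
  if a <= b then \int[lebesgue_measure]_(x in `[a, b]) f x
  else - \int[lebesgue_measure]_(x in `[b, a]) f x.

Definition mx_integral (R : realType) (m n : nat) (a b : R)
    (f : R -> 'M[R]_(m, n)) : 'M[R]_(m, n) :=
  \matrix_(i, j) oriented_integral a b (fun s => f s i j).

(* Main.v *)
(* Splitting the equation into even and odd parts turns both reflection systems
   into one and the same linear system for (w1, w2) = (even part, odd part of u),
     (F - G) w1' + (A - B) w2 = gamma_o,   (F + G) w2' + (A + B) w1 = gamma_e,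
   of which Xcal = block_fundamental X Y is a fundamental matrix.  With k a
   solution of Xcal k = ((F - G)^-1 gamma_o, (F + G)^-1 gamma_e) and Z a primitive
   of k with Z(0) = (X(0)^-1 delta, 0), the candidate is u = (X | Y) Z.  The
   parity of the right-hand side makes the upper half of Z even and the lower half
   odd, so the derivative of u reflects as needed.  Writing k(s) as a part
   involving gamma(s) plus one involving gamma(- s), and substituting s -> - s in
   the latter, produces the two branches of the Green function.  Uniqueness: a
   homogeneous solution is X c, and it vanishes at 0 only if c = 0. *)
Require Import Defs.
From HB Require Import structures.
From mathcomp Require Import all_boot all_order all_algebra.
From mathcomp Require Import all_classical all_reals all_analysis.
From mathcomp Require Import measurable_realfun.

Set Implicit Arguments.
Unset Strict Implicit.
Unset Printing Implicit Defensive.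

Import Order.TTheory GRing.Theory Num.Theory.
Import numFieldNormedType.Exports.

Local Open Scope ring_scope.
Local Open Scope classical_set_scope.

(** * Entrywise differentiation of matrix functions *)

Lemma is_derive_mxP (R : realType) m n (M : R -> 'M[R]_(m, n)) (D : 'M[R]_(m, n)) (t : R) :
  is_derive t 1 M D <-> forall i j, is_derive t 1 (fun s => M s i j) (D i j).
Proof.
split=> [[dM <-] i j|dM].
  apply: DeriveDef; first by move/derivable_mxP : dM; exact.
  by rewrite (derive_mx dM) mxE.
have dM' : derivable M t 1 by apply/derivable_mxP => i j; have [] := dM i j.
apply: DeriveDef => //; rewrite (derive_mx dM'); apply/matrixP => i j.
by rewrite mxE; have [_] := dM i j.
Qed.

Lemma is_derive_mulmx (R : realType) m n p (M : R -> 'M[R]_(m, n))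
    (N : R -> 'M[R]_(n, p)) (DM : 'M[R]_(m, n)) (DN : 'M[R]_(n, p)) (t : R) :
  is_derive t 1 M DM -> is_derive t 1 N DN ->
  is_derive t 1 (fun s => M s *m N s) (DM *m N t + M t *m DN).
Proof.
move=> /is_derive_mxP dM /is_derive_mxP dN; apply/is_derive_mxP => i j.
have dMN k : is_derive t 1 (fun s => M s i k * N s k j)
    (DM i k * N t k j + M t i k * DN k j).
  apply: (is_derive_eq (is_deriveM (dM i k) (dN k j))).
  by rewrite addrC /GRing.scale /= [N t k j * _]mulrC.
rewrite !mxE -big_split /=.
have -> : (fun s => (M s *m N s) i j) = \sum_(k < n) (fun s => M s i k * N s k j).
  by apply/funext => s; rewrite mxE fct_sumE.
exact: (is_derive_sum dMN).
Qed.

Lemma is_derive_reflect (R : realType) (f : R -> R) (d t : R) :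
  is_derive (- t) 1 f d -> is_derive t 1 (fun s => f (- s)) (- d).
Proof.
move=> df; have := @is_derive1_comp R f -%R t _ _ df (is_deriveNid t 1).
by rewrite mulrN1.
Qed.

(** * Continuity of matrix products, determinants and inverses *)

Lemma continuous_mxP (R : realType) (T : topologicalType) m n (M : T -> 'M[R]_(m, n)) :
  continuous M <-> forall i j, continuous (fun s => M s i j).
Proof.
split=> [cM i j s|cM s].
  exact: (cvg_comp _ _ (cM s) (@coord_continuous R m n i j _)).
apply/cvgrPdist_le => /= e e0; near=> x.
rewrite /Num.Def.normr/= mx_normrE (bigmax_le _ (ltW e0))//= => i _.
rewrite !mxE/=; move: i; near: x; apply: filter_forall => /= i.
exact: ((cvgrPdist_le _ _).1 (cM i.1 i.2 s)).
Unshelve. all: by end_near. Qed.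

Lemma continuous_sumf (R : realType) (T : topologicalType) (I : Type) (r : seq I) (P : pred I)
    (f : I -> T -> R) : (forall i, continuous (f i)) ->
  continuous (fun x => \sum_(i <- r | P i) f i x).
Proof.
move=> cf; apply: continuous_big => //; exact: add_continuous.
Qed.

Lemma continuous_prodf (R : realType) (T : topologicalType) (I : Type) (r : seq I) (P : pred I)
    (f : I -> T -> R) : (forall i, continuous (f i)) ->
  continuous (fun x => \prod_(i <- r | P i) f i x).
Proof.
move=> cf; apply: continuous_big => //; exact: mul_continuous.
Qed.

Lemma continuous_mulmx (R : realType) (T : topologicalType) m n p (M : T -> 'M[R]_(m, n))
    (N : T -> 'M[R]_(n, p)) :
  continuous M -> continuous N -> continuous (fun s => M s *m N s).
Proof.
move=> /continuous_mxP cM /continuous_mxP cN; apply/continuous_mxP => i j.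
under eq_fun do rewrite mxE.
apply: continuous_sumf => k s.
by apply: continuousM; [exact: cM|exact: cN].
Qed.

Lemma continuous_det (R : realType) (T : topologicalType) n (M : T -> 'M[R]_n) :
  continuous M -> continuous (fun s => \det (M s)).
Proof.
move=> /continuous_mxP cM; apply: continuous_sumf => s x.
apply: (@continuousM R T (fun=> (-1) ^+ perm.odd_perm s)).
  exact: cst_continuous.
by apply: continuous_prodf => i; exact: cM.
Qed.

(** Cramer's rule: each entry of the inverse is a signed minor divided by the determinant, and the
    minors are themselves determinants of continuous matrices. *)
Lemma continuous_invmx (R : realType) (T : topologicalType) n (M : T -> 'M[R]_n) :
  continuous M -> (forall s, M s \in unitmx) -> continuous (fun s => invmx (M s)).
Proof.
move=> cM uM; apply/continuous_mxP => i j.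
under eq_fun do rewrite /invmx uM !mxE.
move=> s; apply: (@continuousM R T (fun s => (\det (M s))^-1)).
  apply: continuousV; last exact: continuous_det.
  by have := uM s; rewrite unitmxE unitfE.
apply: (@continuousM R T (fun=> (-1) ^+ (j + i))); first exact: cst_continuous.
apply: continuous_det => {s}; apply/continuous_mxP => k l.
by under eq_fun do rewrite !mxE; move/continuous_mxP : cM; exact.
Qed.

(** * Oriented integrals and the fundamental theorem of calculus *)

Lemma continuous_itv_integrable (R : realType) (k : R -> R) (ba bb : bool) (a b : R) :
  continuous k ->
  (@lebesgue_measure R).-integrable [set` Interval (BSide ba a) (BSide bb b)] (EFin \o k).
Proof.
move=> ck; apply: (@integrableS _ _ _ (@lebesgue_measure R) `[a, b]%classic) => //.
  by apply: subset_itvScc; [case: ba|case: bb]; rewrite bnd_simp.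
apply: continuous_compact_integrable; first exact: segment_compact.
exact: continuous_subspaceT.
Qed.

(** Moving the base point to [a], strictly left of both 0 and [t], turns the oriented integral near
    [t] into [F x - F 0] whatever the sign of [x]. The fundamental theorem then applies to [F] at
    the interior point [t]. *)
Lemma is_derive_oriented_integral (R : realType) (k : R -> R) (t : R) :
  continuous k -> is_derive t 1 (fun x => oriented_integral 0 x k) (k t).
Proof.
move=> ck; pose a : R := - (`|t| + 1).
pose F (x : R) : R := (\int[lebesgue_measure]_(s in `[a, x]) k s)%R.
have a0 : a < 0 by rewrite oppr_lt0 ltr_wpDl.
have at_ : a < t.
  by rewrite ltrNl (le_lt_trans (ler_norm _))// normrN ltrDl.
have chasles (x y : R) : a <= x -> x <= y ->
    (\int[lebesgue_measure]_(s in `[x, y]) k s)%R = F y - F x.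
  move=> ax xy; rewrite /F Rintegral_itvB //; last exact: continuous_itv_integrable.
  by rewrite Rintegral_itv_obnd_cbnd//; exact: continuous_itv_integrable.
have [||dF F't] := @continuous_FTC1_closed R k a t (t + 1) _ _ at_ (ck t).
- by rewrite ltrDl.
- exact: continuous_itv_integrable.
have dFt : is_derive t 1 (F - cst (F 0)) (k t).
  rewrite -[k t]subr0; apply: is_deriveB.
  by apply: DeriveDef => //; rewrite -derive1E.
apply: (near_eq_is_derive _ dFt).
near=> x; have ax : a < x by near: x; exact: lt_nbhsr.
rewrite /oriented_integral; case: ifPn => [x0|].
  by rewrite chasles // ltW.
by rewrite -ltNge => x0; rewrite chasles ?(ltW ax) ?(ltW x0)// opprB.
Unshelve. all: by end_near. Qed.

Lemma integral_FTC2 (R : realType) (f Phi : R -> R) (a b : R) :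
  continuous f -> (forall t : R, is_derive t 1 Phi (f t)) -> a <= b ->
  (\int[lebesgue_measure]_(s in `[a, b]) (f s)%:E)%E = (Phi b - Phi a)%:E.
Proof.
move=> cf dPhi; rewrite le_eqVlt => /predU1P[->|ab].
  by rewrite set_itv1 integral_set1 subrr.
have cPhi : continuous Phi.
  by move=> x; apply: differentiable_continuous; apply/derivable1_diffP; have [] := dPhi x.
rewrite (@continuous_FTC2 _ _ Phi) //.
- exact: continuous_subspaceT.
- split; first by move=> x _; have [] := dPhi x.
  + exact/cvg_at_right_filter/cPhi.
  + exact/cvg_at_left_filter/cPhi.
- by move=> x _; rewrite derive1E; have [] := dPhi x.
Qed.

(** The value at 0, where the two branches meet, is left free: a singleton is measurable and null,
    so it affects neither measurability nor the integral. *)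
Lemma Rintegral_piecewise (R : realType) (f g1 g2 P1 P2 : R -> R) (a b : R) :
  continuous g1 -> continuous g2 ->
  (forall t : R, is_derive t 1 P1 (g1 t)) -> (forall t : R, is_derive t 1 P2 (g2 t)) ->
  a <= 0 <= b -> {in `[a, 0[, f =1 g1} -> {in `]0, b], f =1 g2} ->
  (\int[lebesgue_measure]_(s in `[a, b]) f s)%R = (P1 0 - P1 a) + (P2 b - P2 0).
Proof.
move=> cg1 cg2 dP1 dP2 /andP[a0 b0] fg1 fg2.
have mg (g : R -> R) ba bb (x y : R) : continuous g ->
    measurable_fun [set` Interval (BSide ba x) (BSide bb y)] (EFin \o g).
  by move=> cg; exact: measurable_int (continuous_itv_integrable ba bb x y cg).
have fg1' : {in `[a, 0[%classic, EFin \o f =1 EFin \o g1}.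
  by move=> x xI; congr EFin; exact: fg1.
have fg2' : {in `]0, b]%classic, EFin \o f =1 EFin \o g2}.
  by move=> x xI; congr EFin; exact: fg2.
have mf1 : measurable_fun `[a, 0[ (EFin \o f).
  by apply: (eq_measurable_fun (EFin \o g1)); [move=> x /fg1' /= ->|exact: mg].
have mf2 : measurable_fun `]0, b] (EFin \o f).
  by apply: (eq_measurable_fun (EFin \o g2)); [move=> x /fg2' /= ->|exact: mg].
have mf3 : measurable_fun `[0, b] (EFin \o f).
  rewrite (@itv_bndbnd_setU _ _ (BLeft 0) (BRight 0) (BRight b)) ?bnd_simp//.
  apply/measurable_funU => //; split => //.
  by rewrite set_itv1; exact: measurable_fun_set1.
rewrite /Rintegral (@itv_bndbnd_setU _ _ (BLeft a) (BLeft 0) (BRight b)) ?bnd_simp//.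
rewrite integral_setU //; last 2 first.
- exact/measurable_funU.
- apply/disj_setPLR => x /=; rewrite !in_itv/= => /andP[_ x0].
  by rewrite leNgt x0.
have -> : (\int[lebesgue_measure]_(x in `[a, 0%R[) (f x)%:E)%E = (P1 0 - P1 a)%:E.
  rewrite -(integral_FTC2 cg1 dP1 a0) -integral_itv_bndo_bndc; last exact: mg.
  apply: eq_integral => x xI; exact: fg1'.
have -> : (\int[lebesgue_measure]_(x in `[0%R, b]) (f x)%:E)%E = (P2 b - P2 0)%:E.
  rewrite -(integral_FTC2 cg2 dP2 b0).
  rewrite -(@integral_itv_obnd_cbnd _ _ _ (EFin \o f))//.
  rewrite -(@integral_itv_obnd_cbnd _ _ _ (EFin \o g2)); last exact: mg.
  apply: eq_integral => x xI; exact: fg2'.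
by [].
Qed.

(** For [t < 0] the two branches swap sides of 0 and the integral changes sign. These effects
    compensate, so one formula serves both signs of [t]. *)
Lemma oriented_integral_piecewise (R : realType) (f g h P Q : R -> R) (t : R) :
  continuous g -> continuous h ->
  (forall s : R, is_derive s 1 P (g s)) -> (forall s : R, is_derive s 1 Q (h s)) ->
  (forall s, (0 < s <= t) || (t <= s < 0) -> f s = g s) ->
  (forall s, (- t <= s < 0) || (0 < s <= - t) -> f s = h s) ->
  oriented_integral (- t) t f = (P t - P 0) + (Q 0 - Q (- t)).
Proof.
move=> cg ch dP dQ fg fh; rewrite /oriented_integral; case: (leP 0 t) => t0.
  rewrite (ge0_cp t0) (@Rintegral_piecewise _ _ h g Q P) ?oppr_le0 ?t0//.
  - by rewrite addrC.
  - by move=> s; rewrite inE/= in_itv/= => st; apply: fh; rewrite st.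
  - by move=> s; rewrite inE/= in_itv/= => st; apply: fg; rewrite st.
have tN : t < - t by rewrite (lt_trans t0)// oppr_gt0.
rewrite leNgt tN /= (@Rintegral_piecewise _ _ g h P Q) ?oppr_ge0 ?(ltW t0)//.
- by rewrite opprD !opprB.
- by move=> s; rewrite inE/= in_itv/= => st; apply: fg; rewrite st orbT.
- by move=> s; rewrite inE/= in_itv/= => st; apply: fh; rewrite st orbT.
Qed.

(** * Primitives of matrix functions and their parity *)

Lemma mx_primitive (R : realType) m n (K : R -> 'M[R]_(m, n)) (Z0 : 'M[R]_(m, n)) :
  continuous K ->
  exists2 Z : R -> 'M[R]_(m, n), Z 0 = Z0 & forall t : R, is_derive t 1 Z (K t).
Proof.
move=> /continuous_mxP cK.
pose Z (t : R) : 'M[R]_(m, n) :=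
  \matrix_(i, j) (oriented_integral 0 t (fun s => K s i j) + Z0 i j).
exists Z => [|t].
  apply/matrixP => i j; rewrite !mxE /oriented_integral lexx set_itv1.
  by rewrite Rintegral_set1 add0r.
apply/is_derive_mxP => i j.
have -> : (fun s => Z s i j) =
    (fun x => oriented_integral 0 x (fun s => K s i j)) + cst (Z0 i j).
  by apply/funext => s; rewrite !mxE.
rewrite -[K t i j]addr0; apply: is_deriveD.
exact: is_derive_oriented_integral.
Qed.

(** Each entry of [Z (- s) - c *: Z s] has derivative zero and vanishes at 0. The values [c = 1] and
    [c = -1] give even and odd primitives. *)
Lemma primitive_parity (R : realType) m n (Z K : R -> 'M[R]_(m, n)) (c : R) :
  (forall t : R, is_derive t 1 Z (K t)) -> (forall t, K (- t) = - c *: K t) ->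
  Z 0 = c *: Z 0 -> forall t, Z (- t) = c *: Z t.
Proof.
move=> dZ parK Z0 t; apply/matrixP => i j.
have dZij s := (is_derive_mxP Z (K s) s).1 (dZ s) i j.
pose f (s : R) := Z (- s) i j - c * Z s i j.
have df (s : R) : is_derive s 1 f 0.
  have d1 := is_derive_reflect (dZij (- s)).
  have d2 := is_deriveZ c (dZij s).
  apply: (is_derive_eq (is_deriveB d1 d2)).
  by rewrite parK mxE mulNr opprK /GRing.scale/= subrr.
have /eqP := is_derive_0_is_cst t 0 df.
have Z0ij : Z 0 i j = c * Z 0 i j by rewrite {1}Z0 mxE.
rewrite /f oppr0 -Z0ij subrr subr_eq0 => /eqP ->.
by rewrite mxE.
Qed.

(** * Continuity of the block fundamental matrix *)

Lemma continuous_col_mx (R : realType) (T : topologicalType) m1 m2 n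
    (M : T -> 'M[R]_(m1, n)) (N : T -> 'M[R]_(m2, n)) :
  continuous M -> continuous N -> continuous (fun s => col_mx (M s) (N s)).
Proof.
move=> /continuous_mxP cM /continuous_mxP cN; apply/continuous_mxP => i j.
case: (split_ordP i) => k ->.
  by under eq_fun do rewrite col_mxEu; exact: cM.
by under eq_fun do rewrite col_mxEd; exact: cN.
Qed.

Lemma continuous_row_mx (R : realType) (T : topologicalType) m n1 n2
    (M : T -> 'M[R]_(m, n1)) (N : T -> 'M[R]_(m, n2)) :
  continuous M -> continuous N -> continuous (fun s => row_mx (M s) (N s)).
Proof.
move=> /continuous_mxP cM /continuous_mxP cN; apply/continuous_mxP => i j.
case: (split_ordP j) => k ->.
  by under eq_fun do rewrite row_mxEl; exact: cM.
by under eq_fun do rewrite row_mxEr; exact: cN.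
Qed.

Lemma continuous_reflect (R : realType) (T : topologicalType) (f : R -> T) :
  continuous f -> continuous (fun s => f (- s)).
Proof. by move=> cf s; apply: continuous_comp; [exact: oppr_continuous|exact: cf]. Qed.

Lemma continuous_block_fundamental (R : realType) n (X Y : R -> 'M[R]_n) :
  continuous X -> continuous Y -> continuous (block_fundamental X Y).
Proof.
move=> cX cY; have even_odd (V : R -> 'M[R]_n) : continuous V ->
    continuous (even_part V) /\ continuous (odd_part V).
  move=> cV; have cV' := continuous_reflect cV.
  split=> s; apply: (@cvgZl_tmp _ _ _ (nbhs s)).
    by apply: cvgD; [exact: cV|exact: cV'].
  by apply: cvgB; [exact: cV|exact: cV'].
have [[cXe cXo] [cYe cYo]] := (even_odd X cX, even_odd Y cY).
exact: (continuous_col_mx (continuous_row_mx cXe cYo) (continuous_row_mx cXo cYe)).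
Qed.

(** * Solutions of the reflection equation *)

Lemma derive1_val (R : realType) (V : normedModType R) (f : R -> V) (D : V) (t : R) :
  is_derive t 1 f D -> f^`()%classic t = D.
Proof. by move=> [_ <-]; rewrite derive1E. Qed.

Lemma refl_solution_derive (R : realType) n m (F G A B : 'M[R]_n) (g u : R -> 'M[R]_(n, m)) :
  refl_solution F G A B g u -> forall t : R, is_derive t 1 u (u^`()%classic t).
Proof. by case=> du _ t; rewrite derive1E; apply: derivableP. Qed.

Lemma refl_solutionB (R : realType) n m (F G A B : 'M[R]_n) (g u v : R -> 'M[R]_(n, m)) :
  refl_solution F G A B g u -> refl_solution F G A B g v ->
  refl_solution F G A B (fun=> 0) (u - v).
Proof.
move=> su sv; have du := refl_solution_derive su; have dv := refl_solution_derive sv.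
have duv t := is_deriveB (du t) (dv t).
split=> t; first by have [] := duv t.
rewrite /refl_op !(derive1_val (duv _)) -[RHS](subrr (g t)) -{1}(su.2 t) -(sv.2 t).
rewrite /refl_op !fctE !mulmxBr !opprD.
by rewrite !addrA [LHS](ACl (1*3*5*7*2*4*6*8)).
Qed.

Lemma refl_solution0_eq0 (R : realType) n (F G A B : 'M[R]_n) (X : R -> 'M[R]_n)
    (v : R -> 'cV[R]_n) :
  fundamental_matrix F G A B X -> refl_solution F G A B (fun=> 0) v -> v 0 = 0 ->
  v = 0.
Proof.
move=> [_ _ uX0 [_ _ genX]] /genX[c ->].
have colE t : (\sum_i c i *: (fun s : R => col i (X s))) t = X t *m \col_i c i.
  apply/colP => k; rewrite fct_sumE summxE mxE; apply: eq_bigr => i _.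
  by rewrite !mxE mulrC.
rewrite colE => /(congr1 (mulmx (invmx (X 0)))).
rewrite mulKmx // mulmx0 => c0.
by apply/funext => t; rewrite colE c0 mulmx0.
Qed.

(** Variation of constants. As [V] is even and [W] odd, their values at [- t] become [V t] and
    [- W t]; the minus sign is what matches the coefficients [- G] and [- B] of the system for [Y].
    All terms without [v] or [w] then cancel. *)
Lemma refl_solution_mulmx (R : realType) n m (F G A B : 'M[R]_n) (X Y : R -> 'M[R]_n)
    (V W v w : R -> 'M[R]_(n, m)) :
  refl_solution F G A B (fun=> 0) X -> refl_solution F (- G) A (- B) (fun=> 0) Y ->
  (forall t : R, is_derive t 1 V (v t)) -> (forall t : R, is_derive t 1 W (w t)) ->
  (forall t, V (- t) = V t) -> (forall t, W (- t) = - W t) ->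
  (forall t, v (- t) = - v t) -> (forall t, w (- t) = w t) ->
  refl_solution F G A B
    (fun t => F *m (X t *m v t + Y t *m w t) + G *m (Y (- t) *m w t - X (- t) *m v t))
    (fun t => X t *m V t + Y t *m W t).
Proof.
move=> sX sY dV dW eV oW ov ew.
have dX := refl_solution_derive sX; have dY := refl_solution_derive sY.
have du t := is_deriveD (is_derive_mulmx (dX t) (dV t)) (is_derive_mulmx (dY t) (dW t)).
split=> t; first by have [] := du t.
have hX := congr1 (mulmx^~ (V t)) (sX.2 t); have hY := congr1 (mulmx^~ (W t)) (sY.2 t).
move: hX hY; rewrite /refl_op !(derive1_val (du _)).
rewrite !eV !oW !ov !ew !mul0mx !mulmxDl !mulNmx => hX hY.
(* Adding both homogeneous identities, multiplied by [V t] and [W t], to the right-hand side reduces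
   the claim to a permutation of twelve terms. *)
rewrite -[RHS]addr0 -[X in _ = _ + X]addr0 -{1}hX -hY.
rewrite !(mulmxDr, mulmxN, opprD, mulmxA).
by rewrite !addrA [LHS](ACl (2*4*8*6*1*5*9*11*3*7*10*12)).
Qed.

(** * The Green function as a variation of constants kernel *)

(* The integrand of the variation of constants formula is the sum of two such
   terms, with g = gamma and with g = gamma(- _). *)
Definition green_kernel (R : realType) n (X Y : R -> 'M[R]_n) (D E : 'M[R]_n)
    (g : R -> 'cV[R]_n) (s : R) : 'cV[R]_(n + n) :=
  2^-1 *: (invmx (block_fundamental X Y s) *m col_mx D E *m g s).

Lemma continuous_green_kernel (R : realType) n (X Y : R -> 'M[R]_n) (D E : 'M[R]_n)
    (g : R -> 'cV[R]_n) :
  continuous X -> continuous Y -> continuous g ->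
  (forall t, block_fundamental X Y t \in unitmx) ->
  continuous (green_kernel X Y D E g).
Proof.
move=> cX cY cg uXY s; apply: cvgZl_tmp.
apply: continuous_mulmx cg s; apply: continuous_mulmx; last exact: cst_continuous.
exact: continuous_invmx (continuous_block_fundamental cX cY) uXY.
Qed.

(** On the second branch the integrand is [q (- s)] up to the factor [r], with primitive
    [- Q (- s)]. Its increment from [- t] to 0 is that of [Q] from 0 to [t], so both branches yield
    increments over the same range. *)
Lemma mx_integral_green (R : realType) n (F G : 'M[R]_n) (X Y : R -> 'M[R]_n)
    (g : R -> 'cV[R]_n) (P Q : R -> 'cV[R]_(n + n)) (t : R) :
  let p := green_kernel X Y (invmx (F - G)) (invmx (F + G)) g in
  let q := green_kernel X Y (- invmx (F - G)) (invmx (F + G)) (fun s => g (- s)) in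
  continuous p -> continuous q ->
  (forall s : R, is_derive s 1 P (p s)) -> (forall s : R, is_derive s 1 Q (q s)) ->
  mx_integral (- t) t (fun s => green F G X Y t s *m g s) =
    row_mx (X t) (Y t) *m (P t + Q t - (P 0 + Q 0)).
Proof.
move=> p q cp cq dP dQ; set r := row_mx _ _; apply/matrixP => i j; rewrite mxE.
have cmul (k : R -> 'cV[R]_(n + n)) : continuous k -> continuous (fun s => (r *m k s) i j).
  by move=> ck; move/continuous_mxP : (continuous_mulmx (@cst_continuous _ _ r) ck); exact.
have dmul (K k : R -> 'cV[R]_(n + n)) (s : R) : is_derive s 1 K (k s) ->
    is_derive s 1 (fun s => (r *m K s) i j) ((r *m k s) i j).
  move=> dK; have /is_derive_mxP := is_derive_mulmx (is_derive_cst r s 1) dK.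
  by move=> /(_ i j); rewrite mul0mx add0r.
have dP' s := dmul _ _ _ (dP s).
have dQ' (s : R) : is_derive s 1 (fun s => - (r *m Q (- s)) i j) ((r *m q (- s)) i j).
  rewrite -[X in is_derive _ _ _ X]opprK.
  exact: is_deriveN (is_derive_reflect (dmul _ _ _ (dQ (- s)))).
rewrite (@oriented_integral_piecewise _ _ (fun s => (r *m p s) i j)
    (fun s => (r *m q (- s)) i j) (fun s => (r *m P s) i j)
    (fun s => - (r *m Q (- s)) i j)).
- by rewrite oppr0 !opprK mulmxBr !mulmxDr !mxE opprD !addrA [LHS](ACl (1*4*2*3)).
- exact: cmul.
- exact: continuous_reflect (cmul _ cq).
- move=> s st; have -> : green F G X Y t s =
      2^-1 *: (r *m invmx (block_fundamental X Y s)
             *m col_mx (invmx (F - G)) (invmx (F + G))).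
    rewrite /green; case: ifPn => // /negP[].
    case/orP: st => /andP[s1 s2]; apply/orP; [left|right].
      by rewrite (ltW s1).
    by rewrite s1 ltW.
  by rewrite /p /green_kernel -scalemxAr -scalemxAl !mulmxA.
move=> s st; have -> : green F G X Y t s =
    2^-1 *: (r *m invmx (block_fundamental X Y (- s))
           *m col_mx (- invmx (F - G)) (invmx (F + G))).
  (* The first case of [green] is excluded: it would give [s] two opposite signs, or make [t] and
     [- t] both negative or both positive. *)
  rewrite /green st ifF //; apply/negP.
  case/orP: st => /andP[s1 s2] /orP[] /andP[s3 s4].
  - by move: s2; rewrite ltNge s3.
  - have := le_lt_trans s3 s2; have := le_lt_trans s1 s2.
    by rewrite oppr_lt0 => /lt_trans /[apply]; rewrite ltxx.
  - have := lt_le_trans s1 s2; have := lt_le_trans s1 s4.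
    by rewrite oppr_gt0 => /lt_trans /[apply]; rewrite ltxx.
  - by move: s1; rewrite ltNge s4.
by rewrite /q /green_kernel opprK -scalemxAr -scalemxAl !mulmxA.
Qed.

(** * Even and odd parts *)

Lemma block_fundamental_mul_col (R : realType) n (X Y : R -> 'M[R]_n)
    (a b : 'cV[R]_n) (t : R) :
  block_fundamental X Y t *m col_mx a b =
  col_mx (even_part X t *m a + odd_part Y t *m b) (odd_part X t *m a + even_part Y t *m b).
Proof. by rewrite mul_block_col. Qed.

Lemma even_partN (R : realType) (V : lmodType R) (f : R -> V) (t : R) :
  even_part f (- t) = even_part f t.
Proof. by rewrite /even_part opprK addrC. Qed.

Lemma odd_partN (R : realType) (V : lmodType R) (f : R -> V) (t : R) :
  odd_part f (- t) = - odd_part f t.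
Proof. by rewrite /odd_part opprK -scalerN opprB. Qed.

Lemma even_odd_partD (R : realType) (V : lmodType R) (f : R -> V) (t : R) :
  even_part f t + odd_part f t = f t.
Proof.
rewrite /even_part /odd_part -scalerDr addrACA subrr addr0 -mulr2n -(scaler_nat 2 (f t)).
by rewrite scalerA mulVf ?scale1r// pnatr_eq0.
Qed.

Lemma even_odd_partB (R : realType) (V : lmodType R) (f : R -> V) (t : R) :
  even_part f t - odd_part f t = f (- t).
Proof. by rewrite -(even_odd_partD f (- t)) even_partN odd_partN. Qed.

(** * Construction of the solution from coefficients of prescribed parity *)

Theorem theorem6p1 (R : realType) (n : nat) (A B F G : 'M[R]_n)
    (hFpG : F + G \in unitmx) (hFmG : F - G \in unitmx)
    (gamma : R -> 'cV[R]_n) (hgamma : continuous gamma) (delta : 'cV[R]_n)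
    (X Y : R -> 'M[R]_n)
    (hX : fundamental_matrix F G A B X)
    (hY : fundamental_matrix F (- G) A (- B) Y)
    (hXY : forall t, block_fundamental X Y t \in unitmx) :
  (exists! u : R -> 'cV[R]_n,
     refl_solution F G A B gamma u /\ u 0 = delta) /\
  (forall u : R -> 'cV[R]_n,
     refl_solution F G A B gamma u /\ u 0 = delta ->
     forall t, u t = X t *m invmx (X 0) *m delta
       + mx_integral (- t) t (fun s => green F G X Y t s *m gamma s)).
Proof.
have [cX sX uX0 _] := hX; have [cY sY _ _] := hY.
have uniq u v : refl_solution F G A B gamma u /\ u 0 = delta ->
    refl_solution F G A B gamma v /\ v 0 = delta -> u = v.
  move=> [su u0] [sv v0]; apply/eqP; rewrite -subr_eq0; apply/eqP.
  apply: (refl_solution0_eq0 hX (refl_solutionB su sv)).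
  by rewrite -[LHS]/(u 0 - v 0) u0 v0 subrr.
pose D := invmx (F - G); pose E := invmx (F + G).
pose p := green_kernel X Y D E gamma.
pose q := green_kernel X Y (- D) E (fun s => gamma (- s)).
have cp : continuous p by exact: continuous_green_kernel.
have cq : continuous q.
  by apply: continuous_green_kernel => //; exact: continuous_reflect.
(* [P] carries all the initial data and [Q] starts at 0, so their sum starts at the coefficients for
   which [u 0 = delta]. *)
have [P P0 dP] := mx_primitive (col_mx (invmx (X 0) *m delta) 0) cp.
have [Q Q0 dQ] := mx_primitive 0 cq.
pose k s := p s + q s; pose Z s := P s + Q s.
have dZ (s : R) : is_derive s 1 Z (k s) by exact: is_deriveD (dP s) (dQ s).
pose v s := usubmx (k s); pose w s := dsubmx (k s).
(* The opposite signs of [D] in [p] and [q] produce the odd part of [gamma], the equal signs of [E]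
   its even part. *)
have kE s : block_fundamental X Y s *m k s =
    col_mx (D *m odd_part gamma s) (E *m even_part gamma s).
  rewrite /k /p /q /green_kernel -scalerDr -scalemxAr mulmxDr -!mulmxA !mulKVmx //.
  rewrite !mul_col_mx add_col_mx scale_col_mx mulNmx -mulmxBr -mulmxDr.
  by rewrite !scalemxAr.
have XYk s : even_part X s *m v s + odd_part Y s *m w s = D *m odd_part gamma s /\
    odd_part X s *m v s + even_part Y s *m w s = E *m even_part gamma s.
  by apply: eq_col_mx; rewrite -block_fundamental_mul_col vsubmxK kE.
(* Both sides are compared after multiplication by the invertible block matrix at [- s], whose
   off-diagonal blocks change sign, as does the odd part of [gamma]. *)
have kN s : k (- s) = col_mx (- v s) (w s).
  apply: (can_inj (mulKmx (hXY (- s)))); rewrite kE block_fundamental_mul_col.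
  have [e1 e2] := XYk s.
  rewrite !even_partN !odd_partN !mulmxN !mulNmx opprK.
  by rewrite -opprD e1 e2.
have vN s : v (- s) = - v s by rewrite /v kN col_mxKu.
have wN s : w (- s) = w s by rewrite /w kN col_mxKd.
pose V s := usubmx (Z s); pose W s := dsubmx (Z s).
have dV (s : R) : is_derive s 1 V (v s).
  apply/is_derive_mxP => i j; rewrite /v mxE; under eq_fun do rewrite mxE.
  by have /is_derive_mxP := dZ s; exact.
have dW (s : R) : is_derive s 1 W (w s).
  apply/is_derive_mxP => i j; rewrite /w mxE; under eq_fun do rewrite mxE.
  by have /is_derive_mxP := dZ s; exact.
have V0 : V 0 = invmx (X 0) *m delta by rewrite /V /Z P0 Q0 addr0 col_mxKu.
have W0 : W 0 = 0 by rewrite /W /Z P0 Q0 addr0 col_mxKd.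
have VN s : V (- s) = V s.
  rewrite -[RHS]scale1r; apply: (primitive_parity dV); last by rewrite scale1r.
  by move=> t; rewrite scaleN1r.
(* Here [c = -1], and the primitive of the even [w] is odd because it vanishes at 0. *)
have WN s : W (- s) = - W s.
  rewrite -[RHS]scaleN1r; apply: (primitive_parity dW); last by rewrite W0 scaler0.
  by move=> t; rewrite opprK scale1r.
pose u t := X t *m V t + Y t *m W t.
have su : refl_solution F G A B gamma u /\ u 0 = delta.
  split; last by rewrite /u V0 W0 mulmx0 addr0 mulKVmx.
  have [du eu] := refl_solution_mulmx sX sY dV dW VN WN vN wN.
  split=> // t; rewrite eu; have [e1 e2] := XYk t.
  have sumE : X t *m v t + Y t *m w t =
      E *m even_part gamma t + D *m odd_part gamma t.
    rewrite -e1 -e2 -{1}(even_odd_partD X t) -{1}(even_odd_partD Y t) !mulmxDl.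
    by rewrite !addrA [LHS](ACl (2*3*1*4)).
  have diffE : Y (- t) *m w t - X (- t) *m v t =
      E *m even_part gamma t - D *m odd_part gamma t.
    rewrite -e1 -e2 -(even_odd_partB X t) -(even_odd_partB Y t) !mulmxBl !opprD !opprK.
    by rewrite !addrA [LHS](ACl (4*1*3*2)).
  (* Regrouping gives [(F + G) *m E] on the even part of [gamma] and [(F - G) *m D] on the odd part;
     both products are the identity. *)
  rewrite sumE diffE mulmxDr mulmxBr addrACA -mulmxDl -mulmxBl.
  by rewrite !mulKVmx // even_odd_partD.
have uE t : u t = X t *m invmx (X 0) *m delta
    + mx_integral (- t) t (fun s => green F G X Y t s *m gamma s).
  (* The integral is [(X | Y)] times the increment of [Z]. Its initial value contributes exactly the
     term in [delta]. *)
  rewrite (mx_integral_green t cp cq dP dQ) P0 Q0 addr0.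
  rewrite -[P t + Q t]vsubmxK mulmxBr !mul_row_col mulmx0 addr0.
  by rewrite -!mulmxA addrC subrK.
split; first by exists u; split=> // u' /(uniq _ _ su).
by move=> u' su' t; rewrite (uniq _ _ su' su).
Qed.
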